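(* Let $\mu,\nu$ be atomless Borel probability measures on $\mathbb{R}$. Let $l_1,\ldots,l_n\colon\mathbb{R}^2\to\mathbb{R}$ be affine functions such that every two of them, $l_i,l_j$ with $i\neq j$, satisfy the non-degeneracy assumption (A). Put $c=\min\{l_1,\ldots,l_n\}$ and suppose that every set $\{(x,y)\in\mathbb{R}^2 : c(x,y)=l_i(x,y)\}$, $1\le i\le n$, has non-empty interior. Then for every solution $\pi$ to the Monge--Kantorovich problem with marginals $\mu,\nu$ and cost function $c$, there exists a $(\mu,\nu)$-partition $(I_1,\ldots,I_k;\,J_1,\ldots,J_k)$ of order $k\le n$ such that: 1) $\pi$ is concentrated on $\bigcup_{i=1}^k I_i\times J_i$; 2) for every $1\le i\le k$ either $\pi(I_i\times J_i)=0$ or (after a suitable renumbering of the functions $l_i$) $c=l_i$ on $I_i\times J_i$.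
   Context: An affine function on $\mathbb{R}^2$ is a function $l(x,y)=ax+by+d$ with real $a,b,d$. Assumption (A): two distinct affine functions $l_1,l_2$ on $\mathbb{R}^2$ satisfy (A) if the set $\{l_1=l_2\}$ is non-empty and is not parallel to either of the coordinate axes. $\Pi(\mu,\nu)$ denotes the set of Borel probability measures on $\mathbb{R}\times\mathbb{R}$ with marginals $\mu$ (first coordinate) and $\nu$ (second coordinate). A solution to the Monge--Kantorovich problem with marginals $\mu,\nu$ and cost $c$ is a measure $\pi\in\Pi(\mu,\nu)$ minimizing $\pi\mapsto\int c\,d\pi$ over $\Pi(\mu,\nu)$. A $(\mu,\nu)$-partition of order $k$ consists of two representations of the real line (the $x$-axis and the $y$-axis) as unions of $k$ non-empty disjoint connected sets, $\mathbb{R}=I_1\cup\cdots\cup I_k$ and $\mathbb{R}=J_1\cup\cdots\cup J_k$, such that $\mu(I_i)=\nu(J_i)>0$ for all $i\in\{1,\ldots,k\}$.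
   Formalization: Solutions are required to have finite cost, and ''c = l_i on I_i×J_i'' is asserted only off a μ-null set of x and a ν-null set of y; the literal claims fail (e.g. uniform marginals on [0,1], c = min(0, 100−x−y)). *)

(* Defs.v *)
From HB Require Import structures.
From mathcomp Require Import all_boot all_order all_algebra.
From mathcomp Require Import all_fingroup.
From mathcomp Require Import all_classical all_reals all_analysis.

Set Implicit Arguments.
Unset Strict Implicit.
Unset Printing Implicit Defensive.

Import Order.TTheory GRing.Theory Num.Theory.
Import numFieldNormedType.Exports.

Local Open Scope classical_set_scope.
Local Open Scope ring_scope.

(* [line R] is convertible to [R]; it carries the Borel sigma-algebra, and
   [line R * line R] carries the product (= Borel) sigma-algebra. *)
Notation line R := (measurableTypeR R).

Section Affine.
Variable R : realType.

Definition affine_function (l : R * R -> R) : Prop :=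
  exists a b d : R, forall x y : R, l (x, y) = a * x + b * y + d.

(* Meant for a line [S], for which invariance under the translations by
   multiples of [v] says that [v] is a direction vector of [S]. *)
Definition parallel_to (v : R * R) (S : set (R * R)) : Prop :=
  forall p, S p -> forall t : R, S (p.1 + t * v.1, p.2 + t * v.2).

Definition assumption_A (l1 l2 : R * R -> R) : Prop :=
  let S := [set p | l1 p = l2 p] in
  [/\ l1 <> l2, S !=set0, ~ parallel_to (1, 0) S & ~ parallel_to (0, 1) S].

Definition min_cost (n : nat) (l : 'I_n.+1 -> R * R -> R) (p : R * R) : R :=
  \big[Num.min/l ord0 p]_(i < n.+1) l i p.

End Affine.

Section Transport.
Variable R : realType.
Implicit Types mu nu : probability (line R) R.
Implicit Types pi : probability (line R * line R)%type R.

Definition atomless mu : Prop :=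
  ~ exists A : set (line R),
      [/\ measurable A, (0 < mu A)%E
        & forall B : set (line R), measurable B -> B `<=` A ->
            mu B = 0%E \/ mu B = mu A].

Definition coupling mu nu pi : Prop :=
  (forall A : set (line R), measurable A -> pi (fst @^-1` A) = mu A) /\
  (forall B : set (line R), measurable B -> pi (snd @^-1` B) = nu B).

(* The integral of [c] exists in the extended reals; the library's integral
   takes an arbitrary value when it does not. *)
Definition integral_defined pi (c : R * R -> R) : Prop :=
  (\int[pi]_p (EFin \o c)^\+ p < +oo)%E \/
  (\int[pi]_p (EFin \o c)^\- p < +oo)%E.

(* The minimum is required to be finite: when every coupling has an infinite
   cost, all of them would be minimizers. *)
Definition MK_solution mu nu (c : R * R -> R) pi : Prop :=
  [/\ coupling mu nu pi,
      pi.-integrable setT (EFin \o c)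
    & forall pi' : probability (line R * line R)%type R,
        coupling mu nu pi' -> integral_defined pi' c ->
        (\int[pi]_p (c p)%:E <= \int[pi']_p (c p)%:E)%E].

Definition connected_partition (k : nat) (I : 'I_k -> set R) : Prop :=
  partition [set: 'I_k] I [set: R] /\ forall i, connected (I i).

Definition munu_partition mu nu (k : nat) (I J : 'I_k -> set R) : Prop :=
  [/\ connected_partition I, connected_partition J
    & forall i, mu (I i) = nu (J i) /\ (0 < mu (I i))%E].

Definition concentrated_on pi (S : set (R * R)) : Prop := pi (~` S) = 0%E.

(* Equality on [A `*` B] up to null sets of the marginals.  Equality at every
   point cannot be asked of blocks of positive mass covering the whole line:
   take mu = nu = the uniform law on [0, 1] and c = min(0, 100 - x - y).
   As [f] and [g] are continuous in the application, it is everywhere equality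
   when mu and nu charge every nonempty open set. *)
Definition equal_on_block mu nu (f g : R * R -> R) (A B : set R) : Prop :=
  exists N M : set (line R),
    [/\ mu.-negligible N, nu.-negligible M
      & forall x y, (A `\` N) x -> (B `\` M) y -> f (x, y) = g (x, y)].

End Transport.

(* Main.v *)
Require Import Defs.
From HB Require Import structures.
From mathcomp Require Import all_boot all_order all_algebra all_fingroup.
From mathcomp Require Import all_classical all_reals all_analysis.
From mathcomp Require Import measurable_realfun lra.
Import Order.TTheory GRing.Theory Num.Theory.
Import numFieldNormedType.Exports.
Local Open Scope classical_set_scope.
Local Open Scope ring_scope.
Set Implicit Arguments.
Unset Strict Implicit.
Unset Printing Implicit Defensive.

(** Write [l_i (x, y) = a_i x + b_i y + e_i]; assumption (A) makes the [a_i]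
    distinct and the [b_i] distinct.  For a vector [s] of prices put
    [phi x = min_i (a_i x - s_i)] and [psi y = min_i (b_i y + e_i + s_i)].
    Then [phi x + psi y <= c (x, y)], with equality exactly when some [i]
    realises both minima, and then [c (x, y) = l_i (x, y)].  The sets where a
    given [i] is the strict minimiser are intervals [A_i] and [B_i] which cover
    the line up to finitely many points.

    The price vector maximises the concave function [s |-> int (phi + psi)];
    at a maximum, raising [s_i] shows that [A_i] and [B_i] have the same mass,
    so the marginals can be coupled inside the blocks [A_i * B_i], where
    [c = phi + psi].  Comparing with [pi], optimality forces [c = phi + psi]
    [pi]-almost everywhere, that is, [pi] lives on the blocks.  As the first
    moments of mu and nu may be infinite, the maximisation and the comparison
    are done with a part [rho <= pi] that has the same null sets as [pi] and
    finite first moments, the rest of [pi] being left in place. *)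

(** * Lower envelopes of lines *)

Section Envelope.
Variables (R : realType) (n : nat).

(** The seed is itself a value of [f], so folding [Num.min] never leaves the range of [f]. *)
Lemma bigmin_ord0_attained (f : 'I_n.+1 -> R) :
  exists i, \big[Num.min/f ord0]_(j < n.+1) f j = f i.
Proof.
elim/big_ind: _ => [|u v [i ->] [j ->]|i _].
- by exists ord0.
- by case: leP => _; [exists i | exists j].
- by exists i.
Qed.

Implicit Types (p q : 'I_n.+1 -> R) (x y : R).

Definition envelope p q x : R :=
  \big[Num.min/p ord0 * x + q ord0]_(i < n.+1) (p i * x + q i).

(** Strictness makes the cells disjoint; the ties left out are finitely many when the slopes are
    distinct. *)
Definition cell p q (i : 'I_n.+1) : set R :=
  [set x | forall j, j != i -> p i * x + q i < p j * x + q j].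

Lemma envelope_le p q i x : envelope p q x <= p i * x + q i.
Proof. exact: bigmin_le. Qed.

Lemma le_envelope p q m x :
  (forall i, m <= p i * x + q i) -> m <= envelope p q x.
Proof. by move=> h; apply: le_bigmin. Qed.

Lemma envelope_attained p q x : exists i, envelope p q x = p i * x + q i.
Proof. exact: (bigmin_ord0_attained (fun i => p i * x + q i)). Qed.

Lemma envelope_cell p q i x : cell p q i x -> envelope p q x = p i * x + q i.
Proof.
move=> h; apply/eqP; rewrite eq_le envelope_le le_envelope// => j.
by have [->//|/h/ltW] := eqVneq j i.
Qed.

Lemma cell_trivIset p q : trivIset setT (cell p q).
Proof.
move=> i j _ _ [x [hi hj]]; apply/eqP/negP => /negP ij.
by have := lt_trans (hi _ (contra_neq esym ij)) (hj _ ij); rewrite ltxx.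
Qed.

(** A strict inequality between two lines propagates to the right or to the left according to the
    order of their slopes, so one of the two endpoints always serves. *)
Lemma cell_interval p q i : is_interval (cell p q i).
Proof.
move=> x y hx hy z /andP[xz zy] j ji; have := hx j ji; have := hy j ji.
have [ij|ij] := leP (p i) (p j).
- have : 0 <= (p j - p i) * (z - x) by rewrite mulr_ge0// subr_ge0.
  by move=> ? ? ?; lra.
- have : 0 <= (p i - p j) * (y - z) by rewrite mulr_ge0// subr_ge0// ltW.
  by move=> ? ? ?; lra.
Qed.

Lemma cell_measurable p q i : measurable (cell p q i : set (line R)).
Proof. by apply: is_interval_measurable; exact: cell_interval. Qed.

Lemma measurable_envelope p q :
  measurable_fun setT (envelope p q : line R -> R).
Proof.
rewrite /envelope.
have h i : measurable_fun setT ((fun x => p i * x + q i) : line R -> R).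
  exact: measurable_funD.
rewrite (_ : (fun x : R => _) = (fun x : R =>
   \big[Num.min/p ord0 * x + q ord0]_(i <- index_enum 'I_n.+1) (p i * x + q i))) //.
elim: (index_enum _) => [|i r ih].
- by under eq_fun do rewrite big_nil; exact: h.
- under eq_fun do rewrite big_cons.
  exact: measurable_minr.
Qed.

(* Outside the cells two lines of distinct slopes meet, which happens at finitely
   many abscissas. *)
Lemma ties_negligible (m : {measure set (line R) -> \bar R}) p q :
  injective p -> (forall x : line R, m [set x] = 0%E) ->
  m.-negligible (~` \bigcup_i cell p q i).
Proof.
move=> injp m0.
(* The abscissas of the crossings, numbered by pickled pairs; for [i = j] the quotient is [0], one
   more null point. *)
pose F (k : nat) : set (line R) := if unpickle k is Some (i, j)
  then [set (q j - q i) / (p i - p j)] else set0.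
apply: (@negligibleS _ _ _ _ (\bigcup_k F k)); last first.
  apply: negligible_bigcup => k; rewrite /F.
  case: (unpickle k) => [[i j]|]; last exact: negligible_set0.
  by apply/negligibleP; [exact: measurable_set1|exact: m0].
move=> x /= xn.
have [i ei] := envelope_attained p q x.
have : ~ cell p q i x by move=> h; apply: xn; exists i.
move=> /existsNP[j /not_implyP[ji /negP]]; rewrite -leNgt => le_ji.
exists (pickle (i, j)) => //; rewrite /F pickleK/=.
have eij : p j * x + q j = p i * x + q i.
  by apply/eqP; rewrite eq_le le_ji -ei envelope_le.
have pij : p i - p j != 0.
  by rewrite subr_eq0; apply: contra_neq ji => /injp.
by apply: (mulIf pij); rewrite divfK//; lra.
Qed.

(* Minimising over [P] only, a tie goes to the line of largest slope, whose cell
   is the one on the left. *)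
Lemma cell_extension p q (P : {set 'I_n.+1}) : injective p -> P != finset.set0 ->
  exists A : 'I_n.+1 -> set R,
    [/\ forall i, cell p q i `<=` A i, forall i, is_interval (A i),
        trivIset [set i | i \in P] A & \bigcup_(i in [set i | i \in P]) A i = setT].
Proof.
move=> injp /set0Pn[i0 i0P].
exists (fun i => [set x | forall j, j \in P -> p i * x + q i < p j * x + q j
  \/ p i * x + q i = p j * x + q j /\ p j <= p i]); split.
- move=> i x hx j _; have [->|/hx] := eqVneq j i; last by left.
  by right.
- move=> i x y hx hy z /andP[xz zy] j jP.
  have hxj := hx j jP; have hyj := hy j jP.
  have [pij|pij] := ltP (p j) (p i).
  + have : 0 <= (p i - p j) * (y - z) by rewrite mulr_ge0// subr_ge0// ltW.
    have le_y : p i * y + q i <= p j * y + q j by case: hyj => [/ltW|[->]].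
    move=> h; have : p i * z + q i <= p j * z + q j by lra.
    by rewrite le_eqVlt => /predU1P[|]; [right; split=> //; exact: ltW|left].
  + have h : 0 <= (p j - p i) * (z - x) by rewrite mulr_ge0// subr_ge0.
    case: hxj => [|[ex pji]]; first by left; lra.
    have e : p i = p j by apply/eqP; rewrite eq_le pij.
    by right; split=> //; move: ex; rewrite e => ?; lra.
- move=> i j /= iP jP [x [/(_ j jP) hi /(_ i iP) hj]].
  by apply: injp; case: hi hj => [?|[? ?]] [?|[? ?]]; lra.
- apply/seteqP; split => // x _.
  (* First the least value at [x] over [P], then the largest slope among the lines attaining it. *)
  case: (arg_minP (fun i => p i * x + q i) i0P) => i1 i1P min1.
  pose Q := [pred i | (i \in P) && (p i * x + q i == p i1 * x + q i1)].
  have Q1 : Q i1 by apply/andP; split=> //; apply/eqP.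
  case: (arg_maxP p Q1) => i /andP[iP /eqP ei] maxi.
  exists i => // j jP; rewrite ei; have := min1 j jP.
  rewrite /= le_eqVlt => /orP[/eqP e|]; [right|by left].
  by split=> //; apply: maxi; apply/andP; split=> //; apply/eqP.
Qed.

End Envelope.

(** * Splitting off a part with finite moments *)

Section Measures.
Local Open Scope ereal_scope.
Context d (T : measurableType d) (R : realType).
Implicit Types (m r t : {measure set T -> \bar R}).

Lemma finite_measure_of m : m setT < +oo ->
  exists m' : {finite_measure set T -> \bar R}, m' = m :> (set T -> \bar R).
Proof.
move=> mT.
have mfin : fin_num_fun m.
  by apply: lty_fin_num_fun.
have msf : sigma_finite setT m.
  by apply: fin_num_fun_sigma_finite; rewrite ?measure0.
pose F1 := isFinite.Build _ _ _ _ mfin.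
pose F2 := isSFinite.Build _ _ _ _ (sfinite_measure_sigma_finite msf).
pose F3 := isSigmaFinite.Build _ _ _ _ msf.
pose m' : {finite_measure set T -> \bar R} := HB.pack (Measure.sort m) F1 F2 F3.
by exists m'.
Qed.

Lemma probability_of m : m setT = 1 ->
  exists m' : probability T R, m' = m :> (set T -> \bar R).
Proof.
move=> mT.
have [|m' mE] := @finite_measure_of m; first by rewrite mT ltry.
have m'T : m' setT = 1 by rewrite mE.
have m'T1 : m' setT <= 1 by rewrite m'T.
pose P1 := isSubProbability.Build _ _ _ _ m'T1.
pose P2 := isProbability.Build _ _ _ _ m'T.
pose P := HB.pack_for (probability T R) (FiniteMeasure.sort m') P1 P2.
by exists P.
Qed.

Lemma density_measure m (h : T -> R) :
  measurable_fun setT h -> (forall x, 0 <= h x)%R ->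
  exists r, forall A, r A = \int[m]_(x in A) (h x)%:E.
Proof.
move=> mh h0; pose rf A := \int[m]_(x in A) (h x)%:E.
have r0 : rf set0 = 0 by rewrite /rf integral_set0.
have rge0 A : 0 <= rf A by apply: integral_ge0 => x _; rewrite lee_fin.
have rs : semi_sigma_additive rf.
  apply: semi_sigma_additive_nng_induced => [|x]; last by rewrite lee_fin.
  exact/measurable_EFinP.
pose rm := isMeasure.Build _ _ _ rf r0 rge0 rs.
pose r : {measure set T -> \bar R} := HB.pack rf rm.
by exists r.
Qed.

(** The function [h] is almost everywhere the Radon-Nikodym derivative of [r], as both have the same
    integrals over measurable sets; the rest is the change of variables formula. *)
Lemma integral_density (m r : {finite_measure set T -> \bar R}) (h g : T -> R) :
  measurable_fun setT h -> (forall x, 0 <= h x)%R ->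
  measurable_fun setT g -> (forall x, 0 <= g x)%R ->
  (forall A, measurable A -> r A = \int[m]_(x in A) (h x)%:E) ->
  \int[r]_x (g x)%:E = \int[m]_x (g x * h x)%:E.
Proof.
move=> mh h0 mg g0 rE.
have mEh : measurable_fun setT (EFin \o h) by exact/measurable_EFinP.
have mEg : measurable_fun setT (EFin \o g) by exact/measurable_EFinP.
have rm : r `<< m.
  apply/null_content_dominatesP => A mA mA0; rewrite rE//.
  by apply: null_set_integral => //; exact: measurable_funTS.
have intf := Radon_Nikodym_SigmaFinite.f_integrable rm.
have <- := Radon_Nikodym_SigmaFinite.change_of_variables rm
  (fun x => g0 x : 0 <= (EFin \o g) x) measurableT mEg.
have mf := measurable_int _ intf.
apply: ae_eq_integral => //.
- exact: emeasurable_funM.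
- exact/measurable_EFinP/measurable_funM.
- under [X in ae_eq _ _ _ X]eq_fun do rewrite EFinM.
  apply: ae_eqe_mul2l.
  apply: integral_ae_eq => // E _ mE.
  by rewrite -Radon_Nikodym_SigmaFinite.f_integral// rE.
Qed.

(* The two parts have densities [exp (- g)] and [1 - exp (- g)]. *)
Lemma split_integrable (m : {finite_measure set T -> \bar R}) (g : T -> R) :
  measurable_fun setT g -> (forall x, 0 <= g x)%R ->
  exists r t : {finite_measure set T -> \bar R},
    [/\ forall A, measurable A -> m A = r A + t A,
        r `<< m, m `<< r & r.-integrable setT (EFin \o g)].
Proof.
move=> mg g0; pose h x := expR (- g x).
have h0 x : (0 <= h x)%R by exact: expR_ge0.
have h1 x : (0 <= 1 - h x)%R by rewrite subr_ge0 expR_le1 oppr_le0.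
have mh : measurable_fun setT h.
  by apply: (measurableT_comp (@measurable_expR R)); exact: measurable_funN.
have m1h : measurable_fun setT (fun x => 1 - h x)%R by exact: measurable_funB.
have [r' rE'] := density_measure m mh h0.
have [t' tE'] := density_measure m m1h h1.
have mE A : measurable A -> m A = r' A + t' A.
  move=> mA; rewrite rE' tE' -ge0_integralD//; last 4 first.
  - by move=> x _; rewrite lee_fin.
  - by apply/measurable_EFinP; exact: measurable_funTS.
  - by move=> x _; rewrite lee_fin.
  - by apply/measurable_EFinP; exact: measurable_funTS.
  under eq_integral do rewrite -EFinD addrC subrK.
  by rewrite integral_cst// mul1e.
have mT : m setT < +oo by rewrite -ge0_fin_numE// fin_num_measure.
have [|r rr'] := @finite_measure_of r'.
  by apply: le_lt_trans mT; rewrite mE// leeDl.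
have [|t tt'] := @finite_measure_of t'.
  by apply: le_lt_trans mT; rewrite mE// leeDr.
have rE A : r A = \int[m]_(x in A) (h x)%:E by rewrite rr' rE'.
exists r, t; split.
- by move=> A mA; rewrite rr' tt' mE.
- apply/null_content_dominatesP => A mA A0; apply: (etrans (rE A)).
  by apply: null_set_integral => //; apply/measurable_EFinP; exact: measurable_funTS.
(* The density [exp (- g)] vanishes nowhere, so a set of zero [r]-mass is [m]-null. *)
- apply/null_content_dominatesP => A mA A0; have {}A0 := etrans (esym (rE A)) A0.
  have : \int[m]_(x in A) `|(h x)%:E| = 0.
    by under eq_integral do rewrite gee0_abs ?lee_fin//.
  move=> /ae_eq_integral_abs -/(_ mA).
  have mhA : measurable_fun A (EFin \o h).
    by apply/measurable_EFinP; exact: measurable_funTS.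
  move=> /(_ mhA) h0A; apply/negligibleP => //; apply: negligibleS h0A.
  by move=> x Ax /= /(_ Ax) [] /eqP; rewrite gt_eqF// expR_gt0.
- apply/integrableP; split; first exact/measurable_EFinP.
  under eq_integral do rewrite gee0_abs ?lee_fin//.
  rewrite (@integral_density m r h)//.
  (* The integrand [g * exp (- g)] is at most [1] because [exp g >= 1 + g]. *)
  apply: (@le_lt_trans _ _ (\int[m]_x 1)); last by rewrite integral_cst// mul1e.
  apply: ge0_le_integral => //.
  - by move=> x _; rewrite lee_fin mulr_ge0.
  - exact/measurable_EFinP/measurable_funM.
  - move=> x _; rewrite lee_fin /h expRN ler_pdivrMr ?expR_gt0// mul1r.
    by apply: le_trans (expR_ge1Dx _); rewrite lerDr.
Qed.

End Measures.

(** * The dual problem *)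

Section DualProblem.
Variables (R : realType) (n : nat) (a b e : 'I_n.+1 -> R).
Variable rho : {finite_measure set (line R * line R)%type -> \bar R}.
Hypothesis int_fst :
  rho.-integrable setT (fun z : (line R * line R)%type => (z.1 : R)%:E).
Hypothesis int_snd :
  rho.-integrable setT (fun z : (line R * line R)%type => (z.2 : R)%:E).
Implicit Types (s : 'I_n.+1 -> R) (z : (line R * line R)%type).

Definition potential_fst s : R -> R := envelope a (fun i => - s i).

Definition potential_snd s : R -> R := envelope b (fun i => e i + s i).

Lemma envelope_shift (p q q' : 'I_n.+1 -> R) k x :
  (forall i, q i <= q' i + k) -> envelope p q x <= envelope p q' x + k.
Proof.
move=> qq'; have [i ->] := envelope_attained p q' x.
by apply: le_trans (envelope_le _ _ i _) _; rewrite -addrA lerD2l.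
Qed.

(** With [i = j] the prices cancel, which leads to the bound by the cost; with [i <> j] the bound
    decreases as [s i - s j] grows, which gives coercivity. *)
Lemma potentials_le s (i j : 'I_n.+1) (x y : R) :
  potential_fst s x + potential_snd s y <= a i * x + b j * y + e j - (s i - s j).
Proof.
have := envelope_le a (fun i => - s i) i x.
have := envelope_le b (fun i => e i + s i) j y.
by rewrite /potential_fst /potential_snd => ? ?; lra.
Qed.

(** A lower envelope of finitely many lines grows at most linearly, and constants are integrable for
    the finite measure [rho]. *)
Lemma integrable_envelope (p q : 'I_n.+1 -> R) (f : (line R * line R)%type -> line R) :
  measurable_fun setT f -> rho.-integrable setT (fun z => (f z : R)%:E) ->
  rho.-integrable setT (fun z => (envelope p q (f z))%:E).
Proof.
move=> mf intf.
pose g z : R := (\sum_i `|p i|) * `|f z : R| + \sum_i `|q i|.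
apply: (@le_integrable _ _ _ _ _ measurableT _ (EFin \o g)).
- apply/measurable_EFinP.
  exact: (measurableT_comp (measurable_envelope p q) mf).
- move=> z _ /=; rewrite lee_fin [leRHS]ger0_norm; last first.
    by rewrite addr_ge0 ?mulr_ge0 ?sumr_ge0.
  have [i ->] := envelope_attained p q (f z).
  rewrite (le_trans (ler_normD _ _))// normrM lerD ?ler_wpM2r//.
  + by rewrite (bigD1 i)//= lerDl sumr_ge0.
  + by rewrite (bigD1 i)//= lerDl sumr_ge0.
- exact: (integrableD measurableT
    (integrableZl measurableT (\sum_i `|p i|) (integrable_norm intf))
    (finite_measure_integrable_cst rho (\sum_i `|q i|) measurableT)).
Qed.

Lemma integrable_potential_fst s :
  rho.-integrable setT (fun z => (potential_fst s z.1)%:E).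
Proof. by apply: (integrable_envelope _ _ measurable_fst). Qed.

Lemma integrable_potential_snd s :
  rho.-integrable setT (fun z => (potential_snd s z.2)%:E).
Proof. by apply: (integrable_envelope _ _ measurable_snd). Qed.

Lemma integrable_potentials s :
  rho.-integrable setT (fun z => (potential_fst s z.1 + potential_snd s z.2)%:E).
Proof.
exact: (integrableD measurableT (integrable_potential_fst s)
                                (integrable_potential_snd s)).
Qed.

(** Only the potentials given by prices compete, which makes the dual problem finite-dimensional. *)
Definition dual_value s : R :=
  \int[rho]_z (potential_fst s z.1 + potential_snd s z.2).

Let m := fine (rho setT).

Let m_ge0 : 0 <= m. Proof. exact: fine_ge0. Qed.

Lemma Rintegral_le_shift (f g : (line R * line R)%type -> R) k :
  rho.-integrable setT (EFin \o f) -> rho.-integrable setT (EFin \o g) ->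
  (forall z, f z <= g z + k) ->
  \int[rho]_z f z <= \int[rho]_z g z + k * m.
Proof.
move=> intf intg fg.
have intk := finite_measure_integrable_cst rho k measurableT.
rewrite -Rintegral_cst// -(RintegralD measurableT intg intk).
by apply: le_Rintegral => //; exact: (integrableD measurableT intg intk).
Qed.

Lemma dual_value_lipschitz s s' k : (forall i, `|s i - s' i| <= k) ->
  dual_value s <= dual_value s' + (k + k) * m.
Proof.
move=> ss'; apply: Rintegral_le_shift; [exact: integrable_potentials..|].
move=> z; rewrite addrACA; apply: lerD; apply: envelope_shift => i.
- by have := ss' i; rewrite ler_norml => /andP[? ?]; lra.
- by have := ss' i; rewrite ler_norml => /andP[? ?]; lra.
Qed.

(** A common shift of the prices lowers the first potential and raises the second by the same
    amount, so one price can be normalised to zero. *)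
Lemma dual_value_translate s k : dual_value (fun i => s i + k) = dual_value s.
Proof.
rewrite /dual_value; apply: eq_Rintegral => z _.
have shift t t' k' : (forall i, t i = t' i + k') ->
    potential_fst t z.1 + potential_snd t z.2 <=
    potential_fst t' z.1 + potential_snd t' z.2.
  move=> tt'; rewrite -[leRHS]addr0 -(addNr k') addrACA.
  by apply: lerD; apply: envelope_shift => i; have := tt' i => ?; lra.
apply/eqP; rewrite eq_le (shift _ _ k)// (shift _ _ (- k))// => i.
by rewrite addrK.
Qed.

(** Line [i] bounds the first potential and line [j] the second; [K] adds up absolute values over
    all pairs so as not to depend on [i] and [j]. *)
Lemma dual_value_coercive : exists K, forall s i j,
  dual_value s <= K - (s i - s j) * m.
Proof.
pose h (i j : 'I_n.+1) z : R := a i * z.1 + b j * z.2 + e j.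
have inth i j : rho.-integrable setT (EFin \o h i j).
  exact: (integrableD measurableT (integrableD measurableT
    (integrableZl measurableT (a i) int_fst)
    (integrableZl measurableT (b j) int_snd))
    (finite_measure_integrable_cst rho (e j) measurableT)).
exists (\sum_i \sum_j `|\int[rho]_z h i j z|) => s i j.
apply: (@le_trans _ _ (\int[rho]_z h i j z + - (s i - s j) * m)).
  apply: Rintegral_le_shift => //; first exact: integrable_potentials.
  by move=> z; exact: potentials_le.
rewrite mulNr lerD2r (le_trans (ler_norm _))// (bigD1 i)//= (bigD1 j)//=.
by rewrite -addrA lerDl addr_ge0 ?sumr_ge0// => k _; exact: sumr_ge0.
Qed.

Lemma dual_value_continuous :
  continuous (fun v : 'rV[R]_n.+1 => dual_value (fun i => v ord0 i)).
Proof.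
move=> v; apply/(@cvgrPdist_le _ _ _ (nbhs v) (nbhs_filter v)) => eps eps0.
(* This gives [(k + k) * m <= eps]; the extra [1] keeps the denominator positive if [m = 0]. *)
pose k := eps / (m + m + 1).
have k0 : 0 < k by rewrite divr_gt0// ltr_wpDl// addr_ge0.
near=> w.
have vw i : `|v ord0 i - w ord0 i| <= k.
  move: i; near: w; apply: filter_forall => i.
  have /(@cvgrPdist_le _ _ _ (nbhs v) (nbhs_filter v)) :=
    @coord_continuous R _ _ ord0 i v.
  exact.
have kk : k * (m + m + 1) = eps.
  by rewrite divfK// gt_eqF// ltr_wpDl// addr_ge0.
have h1 := dual_value_lipschitz vw.
have h2 : dual_value (w ord0) <= dual_value (v ord0) + (k + k) * m.
  by apply: dual_value_lipschitz => i; rewrite distrC.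
by rewrite ler_norml; apply/andP; split; lra.
Unshelve. all: by end_near.
Qed.

(** Once [s ord0 = 0], coercivity puts every value outside a large box below the value [D0] at zero
    prices; on the box compactness gives a maximiser. *)
Lemma dual_value_max : (0 < rho setT)%E ->
  exists s, forall s', dual_value s' <= dual_value s.
Proof.
move=> rho0.
have m0 : 0 < m by rewrite fine_gt0// rho0 -ge0_fin_numE ?fin_num_measure.
have [K hK] := dual_value_coercive.
pose D0 := dual_value (fun=> 0).
have KD0 : D0 <= K by have := hK (fun=> 0) ord0 ord0; rewrite subrr mul0r subr0.
(* At this radius the coercive bound [K - r * m] equals [D0]. *)
pose r := (K - D0) / m.
have r0 : 0 <= r by rewrite divr_ge0// subr_ge0.
pose A := [set v : 'rV[R]_n.+1 | forall i, `[- r, r]%classic (v ord0 i)].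
have A0 : A 0 by move=> i /=; rewrite mxE in_itv/= lerNl oppr0 r0.
have cA : compact A.
  apply: (@rV_compact R n.+1 (fun=> `[- r, r]%classic)) => i.
  exact: segment_compact.
have [c _ maxc] := EVT_max_rV (ex_intro _ _ A0) cA
  (continuous_subspaceT dual_value_continuous).
exists (c ord0) => s'.
pose s i := s' i + - s' ord0.
rewrite -(dual_value_translate s' (- s' ord0)) -/s.
have [inbox|/existsNP[i]] := pselect (forall i, - r <= s i <= r).
  have := maxc (\row_i s i); rewrite (_ : (\row_i s i) ord0 = s); last first.
    by apply/funext => i; rewrite mxE.
  by apply; apply/mem_set => i /=; rewrite mxE in_itv/=.
move=> /negP; rewrite -ler_norml -ltNge => ri.
apply: (@le_trans _ _ D0); last first.
  have := maxc 0; rewrite (_ : (0 : 'rV[R]_n.+1) ord0 = fun=> 0); last first.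
    by apply/funext => j; rewrite mxE.
  by apply; exact/mem_set.
have s0 : s ord0 = 0 by rewrite /s subrr.
have rm : r * m = K - D0 by rewrite /r divfK// gt_eqF.
have {}ri : r * m < `|s i| * m by rewrite ltr_pM2r.
have := hK s i ord0; have := hK s ord0 i; rewrite s0 => ? ?.
by case: (ler0P (s i)) ri => _ ?; lra.
Qed.

End DualProblem.

(** * Balance of masses at a maximiser of the dual problem *)

Section DualBalance.
Variables (R : realType) (n : nat) (a b e : 'I_n.+1 -> R).
Variable rho : {finite_measure set (line R * line R)%type -> \bar R}.
Hypothesis int_fst :
  rho.-integrable setT (fun z : (line R * line R)%type => (z.1 : R)%:E).
Hypothesis int_snd :
  rho.-integrable setT (fun z : (line R * line R)%type => (z.2 : R)%:E).
Variables (rho1 rho2 : {finite_measure set (line R) -> \bar R}).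
Hypothesis rho1E : forall A, measurable A -> rho1 A = rho (fst @^-1` A).
Hypothesis rho2E : forall A, measurable A -> rho2 A = rho (snd @^-1` A).
Variable s : 'I_n.+1 -> R.
Hypothesis s_max : forall s', dual_value a b e rho s' <= dual_value a b e rho s.

(** These two sets record the effect of raising [s i] by [eps]: off [near_cell] the first potential
    does not drop, and on [far_cell] the second rises by the full [eps]. *)
Let near_cell (i : 'I_n.+1) eps : set R :=
  [set x | a i * x - s i - eps <= potential_fst a s x].

Let far_cell (i : 'I_n.+1) eps : set R :=
  cell b (fun j => e j + (s j + eps * (j == i)%:R)) i.

Let measurable_near_cell i eps : measurable (near_cell i eps : set (line R)).
Proof.
rewrite -[near_cell i eps]setTI.
rewrite (_ : near_cell i eps = (fun x : line R =>
  a i * x - s i - eps <= potential_fst a s x) @^-1` [set true]); last first.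
  by apply/seteqP; split.
apply: measurable_fun_ler => //; last exact: measurable_envelope.
by apply: measurable_funB => //; apply: measurable_funB.
Qed.

Let measurable_far_cell i eps : measurable (far_cell i eps : set (line R)).
Proof. exact: cell_measurable. Qed.

(** Raising [s i] by [eps] changes the dual value by at least [eps] times the mass of [far_cell]
    minus that of [near_cell], and at a maximiser no change is positive. *)
Let perturbation i eps : 0 < eps -> (rho2 (far_cell i eps) <= rho1 (near_cell i eps))%E.
Proof.
move=> eps0; pose s' j := s j + eps * (j == i)%:R.
pose A := fst @^-1` (near_cell i eps) : set (line R * line R)%type.
pose B := snd @^-1` (far_cell i eps) : set (line R * line R)%type.
have mA : measurable A.
  by rewrite -[A]setTI; apply: measurable_fst => //; exact: measurable_near_cell.
have mB : measurable B.
  by rewrite -[B]setTI; apply: measurable_snd => //; exact: measurable_far_cell.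
have intA : rho.-integrable setT (EFin \o (\1_A : _ -> R)).
  by apply: integrable_indic => //; rewrite -ge0_fin_numE ?fin_num_measure.
have intB : rho.-integrable setT (EFin \o (\1_B : _ -> R)).
  by apply: integrable_indic => //; rewrite -ge0_fin_numE ?fin_num_measure.
have intW := integrable_potentials a b e int_fst int_snd.
have int1 : rho.-integrable setT (EFin \o (fun z => \1_B z - \1_A z : R)).
  exact: (integrableB measurableT intB intA).
have int2 : rho.-integrable setT (EFin \o (fun z => eps * (\1_B z - \1_A z) : R)).
  exact: (integrableZl measurableT eps int1).
have key z : potential_fst a s z.1 + potential_snd b e s z.2 + eps * (\1_B z - \1_A z)
    <= potential_fst a s' z.1 + potential_snd b e s' z.2.
  rewrite mulrBr [_ * _ - _]addrC addrACA; apply: lerD.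
    rewrite !indicE; have [zA|zA] := boolP (z \in A).
      rewrite mulr1 lerBlDr; apply: envelope_shift => j.
      by rewrite /s'; case: (j == i); rewrite /= ?mulr1 ?mulr0; lra.
    rewrite mulr0 subr0; apply: le_envelope => j.
    have /negP : ~ near_cell i eps z.1 by move=> ?; move/negP: zA; apply; exact/mem_set.
    rewrite -ltNge => zi; have [->|ji] := eqVneq j i.
      by rewrite /s' eqxx mulr1; lra.
    by rewrite /s' (negbTE ji) mulr0 addr0 envelope_le.
  rewrite !indicE; have [zB|zB] := boolP (z \in B).
    rewrite mulr1 [leRHS](envelope_cell (set_mem zB)) eqxx mulr1.
    have := envelope_le b (fun j => e j + s j) i z.2.
    by rewrite /potential_snd => ?; lra.
  rewrite mulr0 addr0 -[leRHS]addr0; apply: envelope_shift => j.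
  rewrite addr0 lerD2l /s' lerDl.
  by rewrite mulr_ge0// ltW.
have := le_Rintegral measurableT (integrableD measurableT (intW s) int2) (intW s')
  (fun z _ => key z).
rewrite [leLHS](RintegralD measurableT (intW s) int2).
rewrite (RintegralZl eps measurableT int1) (RintegralB measurableT intB intA).
rewrite /Rintegral !integral_indic// !setIT => /le_trans/(_ (s_max s')).
rewrite gerDl pmulr_rle0// subr_le0 -lee_fin !fineK ?fin_num_measure//.
by rewrite rho1E// rho2E.
Qed.

Hypothesis inj_a : injective a.
Hypothesis inj_b : injective b.
Hypothesis rho1_points : forall x : line R, rho1 [set x] = 0%E.
Hypothesis rho2_points : forall x : line R, rho2 [set x] = 0%E.

(** As [eps] tends to zero, the far cells increase to the cell, while the near cells decrease to the
    set where [i] is a minimiser, strict or not; the latter exceeds the cell by ties only, a null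
    set. *)
Let cell_le i :
  (rho2 (cell b (fun j => e j + s j)%R i) <= rho1 (cell a (fun j => - s j)%R i))%E.
Proof.
pose eps m : R := m.+1%:R^-1.
have eps_gt0 m : 0 < eps m by rewrite invr_gt0.
have eps_nincr m k : (m <= k)%N -> eps k <= eps m.
  by move=> mk; rewrite lef_pV2 ?posrE// ler_nat.
have mnear : measurable (\bigcap_m near_cell i (eps m) : set (line R)).
  by apply: bigcap_measurable => // m _; exact: measurable_near_cell.
have farE : \bigcup_m far_cell i (eps m) = cell b (fun j => e j + s j) i.
  apply/seteqP; split => [y [m _ h] j ji|y h].
    have := h j ji; rewrite eqxx (negbTE ji) mulr1 mulr0.
    by have := eps_gt0 m => ? ?; lra.
  have gap j : j != i -> 0 < b j * y + (e j + s j) - (b i * y + (e i + s i)).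
    by move=> /h; rewrite subr_gt0.
  (* There are finitely many competitors [j], so one [m] suits all the gaps. *)
  have [m _ /(_ m (leqnn m)) hm] : \forall m \near \oo, forall j, j != i ->
      eps m < b j * y + (e j + s j) - (b i * y + (e i + s i)).
    apply: filter_forall => j; have [->|/gap gj] := eqVneq j i.
      exact: nearW.
    by apply: filterS (near_infty_natSinv_lt (PosNum gj)) => m + _.
  exists m => // j ji; have := hm j ji; rewrite eqxx (negbTE ji) mulr1 mulr0.
  by move=> ?; lra.
have nearE : \bigcap_m near_cell i (eps m) `<=`
    cell a (fun j => - s j) i `|` ~` \bigcup_j cell a (fun j => - s j) j.
  move=> x hx; have [|xi] := pselect (cell a (fun j => - s j) i x); first by left.
  right=> -[j _ xj]; have ji : j != i by apply: contra_not_neq xi => <-.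
  have := xj i; rewrite eq_sym => /(_ ji); rewrite -subr_gt0 => gap.
  have [m _ /(_ m (leqnn m)) hm] := near_infty_natSinv_lt (PosNum gap).
  have := hx m I; rewrite /near_cell /= /potential_fst (envelope_cell xj).
  by rewrite lerBlDr -lerBlDl leNgt hm.
have cvg_near : (rho1 \o (fun m => near_cell i (eps m))) @ \oo -->
    rho1 (\bigcap_m near_cell i (eps m)).
  apply: nonincreasing_cvg_mu => //.
  - by rewrite -ge0_fin_numE ?fin_num_measure.
  - move=> m k mk; apply/subsetPset => x /=; rewrite /near_cell/= => h.
    by apply: le_trans h; rewrite lerB// eps_nincr.
have cvg_far : (rho2 \o (fun m => far_cell i (eps m))) @ \oo -->
    rho2 (\bigcup_m far_cell i (eps m)).
  apply: nondecreasing_cvg_mu => //; first by rewrite farE; exact: cell_measurable.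
  move=> m k mk; apply/subsetPset => x h j ji; have := h j ji.
  rewrite eqxx (negbTE ji) !mulr1 !mulr0; have := eps_nincr _ _ mk.
  by move=> ? ?; lra.
rewrite -farE (@le_trans _ _ (rho1 (\bigcap_m near_cell i (eps m))))//.
  apply: (lee_cvg_to cvg_far cvg_near); apply: nearW => m.
  exact: perturbation.
have mC j : measurable (cell a (fun j => - s j) j : set (line R)).
  exact: cell_measurable.
have mU : measurable (\bigcup_j cell a (fun j => - s j) j : set (line R)).
  by apply: fin_bigcup_measurable => // j _; exact: mC.
apply: (@le_trans _ _ (rho1 (cell a (fun j => - s j)%R i `|`
    ~` \bigcup_j cell a (fun j => - s j)%R j))).
  by apply: le_measure; rewrite ?inE//; apply: measurableU => //; exact: measurableC.
rewrite measureU0//; first exact: measurableC.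
by apply/negligibleP; [exact: measurableC|exact: ties_negligible].
Qed.

Let sum_cells (r : {finite_measure set (line R) -> \bar R}) (p q : 'I_n.+1 -> R) :
  injective p -> (forall x : line R, r [set x] = 0%E) ->
  \sum_i fine (r (cell p q i)) = fine (r setT).
Proof.
move=> injp r0; have mC i : measurable (cell p q i : set (line R)).
  exact: cell_measurable.
have mU : measurable (\bigcup_i cell p q i : set (line R)).
  by apply: fin_bigcup_measurable => // j _; exact: mC.
rewrite -(setvU (\bigcup_i cell p q i)) setUC measureU0//; last 2 first.
- exact: measurableC.
- by apply/negligibleP; [exact: measurableC|exact: ties_negligible].
rewrite (_ : [set: 'I_n.+1] = [set` predT]); last by apply/seteqP.
rewrite bigcup_pred sum_fine; last first.
  by move=> i _; rewrite fin_num_measure.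
by rewrite measure_bigsetU_ord//; exact: cell_trivIset.
Qed.

(** The inequalities [cell_le] point the same way for all indices, and both sides sum to the mass of
    [rho]; hence none is strict. *)
Lemma dual_balance i :
  rho1 (cell a (fun j => - s j) i) = rho2 (cell b (fun j => e j + s j) i).
Proof.
have fineE (r : {finite_measure set (line R) -> \bar R}) p q j :
    r (cell p q j) = (fine (r (cell p q j)))%:E.
  by rewrite fineK// fin_num_measure//; exact: cell_measurable.
rewrite [LHS]fineE [RHS]fineE; congr EFin.
have le_cell j : fine (rho2 (cell b (fun j => e j + s j) j))
    <= fine (rho1 (cell a (fun j => - s j) j)) ?= iff
    (fine (rho2 (cell b (fun j => e j + s j) j)) ==
     fine (rho1 (cell a (fun j => - s j) j))).
  by split=> //; rewrite -lee_fin -!fineE; exact: cell_le.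
have := leif_sum (fun j (_ : true) => le_cell j).
rewrite !sum_cells// rho1E// rho2E// !preimage_setT => -[_].
by rewrite eqxx => /esym/forallP/(_ i)/eqP.
Qed.

End DualBalance.

(** * Couplings supported by blocks *)

Section BlockCoupling.
Local Open Scope ereal_scope.
Context d1 d2 (T1 : measurableType d1) (T2 : measurableType d2) (R : realType).
Variables (r1 : {finite_measure set T1 -> \bar R})
          (r2 : {finite_measure set T2 -> \bar R}).
Variables (n : nat) (A : 'I_n.+1 -> set T1) (B : 'I_n.+1 -> set T2).
Hypothesis mA : forall i, measurable (A i).
Hypothesis mB : forall i, measurable (B i).

Lemma sum_measureI d (T : measurableType d) (r : {finite_measure set T -> \bar R})
    (E : 'I_n.+1 -> set T) (C : set T) :
  (forall i, measurable (E i)) -> trivIset setT E -> r (~` \bigcup_i E i) = 0 ->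
  measurable C -> \sum_i r (C `&` E i) = r C.
Proof.
move=> mE tE E0 mC.
have mU : measurable (\bigcup_i E i) by apply: fin_bigcup_measurable.
rewrite -measure_bigsetU_ord//; last 2 first.
- by move=> i; exact: measurableI.
- exact: trivIset_setIl.
rewrite -[LHS](@measureU0 _ _ _ r _ (C `&` ~` \bigcup_i E i)); last 3 first.
- by apply: bigsetU_measurable => i _; exact: measurableI.
- by apply: measurableI => //; exact: measurableC.
- by apply: subset_measure0 E0 => //; [apply: measurableI => //; exact: measurableC|
    exact: measurableC].
congr (r _); rewrite -bigcup_pred (_ : [set` _] = setT); last by apply/seteqP.
by rewrite -setI_bigcupr -setIUr setUv setIT.
Qed.

Let inv_mass_ge0 i : (0 <= (fine (r1 (A i)))^-1)%R.
Proof. by rewrite invr_ge0 fine_ge0. Qed.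

(** Dividing by the common mass gives this product the two restrictions as marginals; for a massless
    [A i] the inverse of zero is zero and the block vanishes. *)
Let block i : {measure set (T1 * T2) -> \bar R} :=
  mscale (NngNum (inv_mass_ge0 i)) (mrestr r1 (mA i) \x mrestr r2 (mB i)).

Let blockE i C D : measurable C -> measurable D ->
  block i (C `*` D) = ((fine (r1 (A i)))^-1)%R%:E * (r1 (C `&` A i) * r2 (D `&` B i)).
Proof.
by move=> mC mD; congr (_ * _); exact: product_measure1E.
Qed.

(** Inside each block the two coordinates are coupled independently, which the equality of masses
    permits; the blocks are then added up. *)
Lemma block_coupling : trivIset setT A -> trivIset setT B ->
  (forall i, r1 (A i) = r2 (B i)) ->
  r1 (~` \bigcup_i A i) = 0 -> r2 (~` \bigcup_i B i) = 0 ->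
  exists beta : {measure set (T1 * T2) -> \bar R},
    [/\ forall C, measurable C -> beta (fst @^-1` C) = r1 C,
        forall D, measurable D -> beta (snd @^-1` D) = r2 D
      & beta (~` \bigcup_i (A i `*` B i)) = 0].
Proof.
move=> tA tB AB A0 B0.
have finA i C : measurable C -> r1 (C `&` A i) \is a fin_num.
  by move=> mC; rewrite fin_num_measure//; exact: measurableI.
have finB i D : measurable D -> r2 (D `&` B i) \is a fin_num.
  by move=> mD; rewrite fin_num_measure//; exact: measurableI.
(* [msum] is indexed by natural numbers, hence [inord], which [betaE] removes. *)
pose beta : {measure set (T1 * T2) -> \bar R} := msum (fun k => block (inord k)) n.+1.
have betaE E : beta E = \sum_(i < n.+1) block i E.
  by rewrite /beta /msum; apply: eq_bigr => i _; rewrite inord_val.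
exists beta; split.
- move=> C mC; rewrite -setXT betaE -(sum_measureI mA tA A0 mC).
  apply: eq_bigr => i _; rewrite blockE// setTI -AB.
  have [r0|r0] := eqVneq (r1 (A i)) 0.
    rewrite r0 mule0 mule0; apply/esym; apply: subset_measure0 r0 => //.
    exact: measurableI.
  rewrite -{2}(fineK (fin_num_measure r1 _ (mA i))) muleCA -EFinM mulVf ?mule1//.
  by rewrite fine_eq0// fin_num_measure.
- move=> D mD; rewrite -setTX betaE -(sum_measureI mB tB B0 mD).
  apply: eq_bigr => i _; rewrite blockE// setTI.
  have [r0|r0] := eqVneq (r1 (A i)) 0.
    rewrite r0 mul0e mule0; apply/esym; rewrite AB in r0.
    by apply: subset_measure0 r0 => //; exact: measurableI.
  rewrite -{2}(fineK (fin_num_measure r1 _ (mA i))) muleA -EFinM mulVf ?mul1e//.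
  by rewrite fine_eq0// fin_num_measure.
- have mAB : measurable (\bigcup_i (A i `*` B i)).
    by apply: fin_bigcup_measurable => // i _; exact: measurableX.
  rewrite betaE big1// => i _.
  have mCA := measurableC (mA i); have mCB := measurableC (mB i).
  (* A point outside all blocks misses [A i] or [B i]; both strips are null for the [i]-th
     product. *)
  apply: (@subset_measure0 _ _ _ _ _ ((~` A i `*` setT) `|` (setT `*` ~` B i))).
  + exact: measurableC.
  + by apply: measurableU; exact: measurableX.
  + move=> [x y] /= xy; have [Ax|] := pselect (A i x); last by left.
    by right; split=> // By; apply: xy; exists i.
  + have null1 : block i (~` A i `*` setT) = 0.
      by rewrite blockE// setICl measure0 mul0e mule0.
    have null2 : block i (setT `*` ~` B i) = 0.
      by rewrite blockE// setICl measure0 !mule0.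
    by apply: (etrans (measureU0 _ _ null2)) => //; exact: measurableX.
Qed.

End BlockCoupling.

(** * Optimal plans live on the blocks *)

Section MeasureSplit.
Local Open Scope ereal_scope.
Context d (T : measurableType d) (R : realType).
Variables m r t : {measure set T -> \bar R}.
Hypothesis mE : forall A, measurable A -> m A = r A + t A.
Variable f : T -> \bar R.

Let mE' A : measurable A -> A `<=` setT -> m A = measure_add r t A.
Proof. by move=> mA _; rewrite measure_addE mE. Qed.

Lemma integrable_split :
  m.-integrable setT f <-> r.-integrable setT f /\ t.-integrable setT f.
Proof.
have absE : measurable_fun setT f ->
    \int[m]_x `|f x| = \int[r]_x `|f x| + \int[t]_x `|f x|.
  move=> mf; rewrite (eq_measure_integral (measure_add r t) mE').
  by apply: ge0_integral_measure_add => //; exact: measurableT_comp.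
split=> [/integrableP[mf]|[/integrableP[mf fr] /integrableP[_ ft]]].
- rewrite absE// => foo; split; apply/integrableP; split=> //; apply: le_lt_trans foo.
  + by rewrite leeDl// integral_ge0.
  + by rewrite leeDr// integral_ge0.
- by apply/integrableP; split=> //; rewrite absE// lte_add_pinfty.
Qed.

Lemma integral_split : r.-integrable setT f -> t.-integrable setT f ->
  \int[m]_x f x = \int[r]_x f x + \int[t]_x f x.
Proof.
move=> fr ft; rewrite (eq_measure_integral (measure_add r t) mE').
by apply: integral_measure_add => //; exact: measurable_int fr.
Qed.

End MeasureSplit.

(** * Image measures and integrals of functions of one coordinate *)

Section Marginals.
Local Open Scope ereal_scope.
Context d1 d2 (X : measurableType d1) (Y : measurableType d2) (R : realType).
Variable phi : X -> Y.
Hypothesis mphi : measurable_fun setT phi.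

Lemma marginal_measure (m : {finite_measure set X -> \bar R}) :
  exists m' : {finite_measure set Y -> \bar R}, forall A, m' A = m (phi @^-1` A).
Proof.
have [m' m'E] : exists m' : {finite_measure set Y -> \bar R},
    m' = pushforward m phi :> (set Y -> \bar R).
  apply: finite_measure_of.
  by rewrite /= /pushforward preimage_setT -ge0_fin_numE// fin_num_measure.
by exists m' => A; rewrite m'E.
Qed.

(** The integral of a function that factors through [phi] sees only the image measure, so
    rearranging a plan preserves the integral of each potential. *)
Lemma integral_marginal (m1 m2 : {measure set X -> \bar R}) (g : Y -> \bar R) :
  (forall A, measurable A -> m1 (phi @^-1` A) = m2 (phi @^-1` A)) ->
  measurable_fun setT g -> m1.-integrable setT (g \o phi) ->
  m2.-integrable setT (g \o phi) /\ \int[m2]_x g (phi x) = \int[m1]_x g (phi x).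
Proof.
move=> m12 mg int1.
have pushE h : \int[pushforward m1 phi]_y h y = \int[pushforward m2 phi]_y h y.
  by apply: eq_measure_integral => // A mA _; exact: m12.
have absE (m : {measure set X -> \bar R}) :
    \int[pushforward m phi]_y `|g y| = \int[m]_x `|g (phi x)|.
  rewrite -[RHS](ge0_integral_pushforward mphi m (D := setT) (f := abse \o g))//.
    exact: measurableT_comp.
  by move=> y _; exact: abse_ge0.
have int2 : m2.-integrable setT (g \o phi).
  have /integrableP[mgphi int1'] := int1; apply/integrableP; split=> //.
  by rewrite -absE -pushE absE.
split=> //.
rewrite -[LHS](integral_pushforward mphi mg (D := setT) int2)//.
by rewrite -[RHS](integral_pushforward mphi mg (D := setT) int1)// pushE.
Qed.

End Marginals.

(* Only the part [rho] of [pi = rho + tau] is rearranged: [tau] cancels out of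
   the comparison, so neither [c] nor [W] has to be integrable for [mu \x nu]. *)
Lemma optimal_potential_ae (R : realType) (mu nu : probability (line R) R)
    (c W : R * R -> R) (pi : probability (line R * line R)%type R)
    (rho tau : {finite_measure set (line R * line R)%type -> \bar R})
    (beta : {measure set (line R * line R)%type -> \bar R}) :
  MK_solution mu nu c pi ->
  (forall A, measurable A -> pi A = (rho A + tau A)%E) ->
  (forall A : set (line R), measurable A -> beta (fst @^-1` A) = rho (fst @^-1` A)) ->
  (forall A : set (line R), measurable A -> beta (snd @^-1` A) = rho (snd @^-1` A)) ->
  (forall z, W z <= c z) ->
  rho.-integrable setT (EFin \o W) -> beta.-integrable setT (EFin \o W) ->
  (\int[beta]_z (W z)%:E = \int[rho]_z (W z)%:E)%E ->
  beta.-negligible [set z | c z <> W z] ->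
  rho.-negligible [set z | c z <> W z].
Proof.
move=> [[pi1 pi2] intc opt] piE beta1 beta2 Wc rhoW betaW intW beta_eq.
have [rhoc tauc] := (integrable_split piE _).1 intc.
have mc := measurable_int _ intc; have mW := measurable_int _ rhoW.
have betac : beta.-integrable setT (EFin \o c).
  apply/integrableP; split=> //.
  have -> : (\int[beta]_z `|(EFin \o c) z| = \int[beta]_z `|(EFin \o W) z|)%E.
    apply: ae_eq_integral => //; [exact: measurableT_comp..|].
    by apply: negligibleS beta_eq => z /= h e; apply: h => _; rewrite /= e.
  by have /integrableP[] := betaW.
have intcW : (\int[beta]_z (c z)%:E = \int[beta]_z (W z)%:E)%E.
  apply: ae_eq_integral => //.
  by apply: negligibleS beta_eq => z /= h e; apply: h => _; rewrite e.
(* The competitor replaces [rho] by [beta], which has the same marginals, and keeps [tau]. *)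
have [|pi' pi'E] := @probability_of _ _ _ (measure_add beta tau).
  apply: (etrans (measure_addE _ _ _)).
  rewrite -(preimage_setT fst) beta1// preimage_setT -piE//.
  exact: probability_setT.
have pi'A A : measurable A -> pi' A = (beta A + tau A)%E.
  by move=> _; rewrite pi'E; exact: measure_addE.
have pi'c : pi'.-integrable setT (EFin \o c) by apply/(integrable_split pi'A).
have coup' : coupling mu nu pi'.
  split=> A mA.
  - have mfA : measurable (fst @^-1` A : set (line R * line R)%type).
      by rewrite -[_ @^-1` _]setTI; exact: measurable_fst.
    by rewrite pi'A// beta1// -piE// pi1.
  - have msA : measurable (snd @^-1` A : set (line R * line R)%type).
      by rewrite -[_ @^-1` _]setTI; exact: measurable_snd.
    by rewrite pi'A// beta2// -piE// pi2.
have def' : integral_defined pi' c.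
  left; have := integrable_pos_fin_num measurableT pi'c.
  by rewrite ge0_fin_numE// integral_ge0.
have := opt pi' coup' def'.
rewrite (integral_split piE rhoc tauc) (integral_split pi'A betac tauc).
(* The finite [tau] term cancels: [c] has at most the [rho]-integral of [W], although [W <= c], so
   the gap [c - W] integrates to zero. *)
rewrite leeD2rE; last exact: integrable_fin_num.
rewrite intcW intW => le_rho.
have gap0 : (\int[rho]_z `|(c z - W z)%:E| = 0)%E.
  under eq_integral do rewrite gee0_abs ?lee_fin ?subr_ge0// EFinB.
  rewrite integralB_EFin//; apply/eqP; rewrite eq_le sube_le0 le_rho/=.
  rewrite sube_ge0; last by rewrite integrable_fin_num.
  by apply: le_integral => // z _; rewrite lee_fin.
move/ae_eq_integral_abs : gap0 => /(_ measurableT) gap0.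
have /gap0 : measurable_fun setT (fun z => (c z - W z)%:E : \bar R).
  by apply/measurable_EFinP; apply: measurable_funB; apply/measurable_EFinP.
apply: negligibleS => z /= cW /(_ I) [/eqP].
by rewrite subr_eq0 => /eqP.
Qed.

(** * Potentials, cells and the minimum cost *)

Section BlockStructure.
Variables (R : realType) (n : nat) (a b e : 'I_n.+1 -> R).
Variable l : 'I_n.+1 -> R * R -> R.
Hypothesis lE : forall i x y, l i (x, y) = a i * x + b i * y + e i.

Lemma min_cost_le i z : min_cost l z <= l i z.
Proof. exact: bigmin_le. Qed.

Lemma min_cost_attained z : exists i, min_cost l z = l i z.
Proof. exact: (bigmin_ord0_attained (fun i => l i z)). Qed.

Definition cell_fst (s : 'I_n.+1 -> R) := cell a (fun j => - s j).

Definition cell_snd (s : 'I_n.+1 -> R) := cell b (fun j => e j + s j).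

Lemma potentials_le_cost s z :
  potential_fst a s z.1 + potential_snd b e s z.2 <= min_cost l z.
Proof.
have [i ->] := min_cost_attained z; case: z => x y; rewrite lE.
by have := potentials_le a b e s i i x y; rewrite subrr => ?; lra.
Qed.

Lemma potentials_block s i x y : cell_fst s i x -> cell_snd s i y ->
  potential_fst a s x + potential_snd b e s y = l i (x, y).
Proof.
move=> hx hy; rewrite lE /potential_fst /potential_snd.
by rewrite (envelope_cell hx) (envelope_cell hy); lra.
Qed.

(** The cost is squeezed between the sum of the potentials, which equals [l i] on the block, and
    [l i]. *)
Lemma min_cost_block s i x y : cell_fst s i x -> cell_snd s i y ->
  min_cost l (x, y) = l i (x, y).
Proof.
move=> hx hy; apply/eqP; rewrite eq_le min_cost_le.
by rewrite -(potentials_block hx hy) (potentials_le_cost s (x, y)).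
Qed.

(** An index [k] attaining the cost must realise both minima when the potentials add up to the cost;
    strict minimisers being unique, [k = i] and [k = j]. *)
Lemma tight_block s z : min_cost l z = potential_fst a s z.1 + potential_snd b e s z.2 ->
  (\bigcup_i cell_fst s i) z.1 -> (\bigcup_i cell_snd s i) z.2 ->
  (\bigcup_i (cell_fst s i `*` cell_snd s i)) z.
Proof.
case: z => x y /= tight [i _ xi] [j _ yj].
have [k ck] := min_cost_attained (x, y).
have := envelope_le a (fun j => - s j) k x.
have := envelope_le b (fun j => e j + s j) k y.
move: tight; rewrite ck lE /potential_fst /potential_snd => tight hb ha.
have ki : k = i.
  apply/eqP/negP => /negP ki; have := xi k ki.
  by move: ha hb tight; rewrite (envelope_cell xi) (envelope_cell yj) => ? ? ? ?; lra.
have kj : k = j.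
  apply/eqP/negP => /negP kj; have := yj k kj.
  by move: ha hb tight; rewrite (envelope_cell xi) (envelope_cell yj) => ? ? ? ?; lra.
by exists k => //; split=> /=; [rewrite ki|rewrite kj].
Qed.

Lemma atomless_point (mu : probability (line R) R) (x : line R) :
  atomless mu -> mu [set x] = 0%E.
Proof.
move=> muA; apply: contrapT => mux; apply: muA; exists [set x]; split.
- exact: measurable_set1.
- by rewrite lt0e measure_ge0 andbT; apply/eqP.
- move=> B mB /subset_set1[->|->]; [left; exact: measure0|by right].
Qed.

Hypothesis inj_a : injective a.
Hypothesis inj_b : injective b.

(** The prices solve the dual problem for [rho]; complementary slackness then holds [rho]-almost
    everywhere and passes to [pi], which has the same null sets. *)
Lemma solution_blocks (mu nu : probability (line R) R)
    (pi : probability (line R * line R)%type R) :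
  atomless mu -> atomless nu -> MK_solution mu nu (min_cost l) pi ->
  exists s, pi.-negligible (~` \bigcup_i (cell_fst s i `*` cell_snd s i)).
Proof.
move=> muA nuA sol; have [[pi1 pi2] _ _] := sol.
(* Integrability of this [g] means finite first moments in both coordinates. *)
pose g (z : (line R * line R)%type) : R := `|z.1 : R| + `|z.2 : R|.
have mg : measurable_fun setT g.
  by apply: measurable_funD; apply: measurableT_comp => //.
have g0 z : 0 <= g z by rewrite addr_ge0.
have [rho [tau [piE rho_pi pi_rho intg]]] := split_integrable pi mg g0.
have int_fst : rho.-integrable setT (fun z : (line R * line R)%type => (z.1 : R)%:E).
  apply: le_integrable intg => //; first exact/measurable_EFinP.
  by move=> z _; rewrite /= lee_fin (ger0_norm (g0 z)) lerDl.
have int_snd : rho.-integrable setT (fun z : (line R * line R)%type => (z.2 : R)%:E).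
  apply: le_integrable intg => //; first exact/measurable_EFinP.
  by move=> z _; rewrite /= lee_fin (ger0_norm (g0 z)) lerDr.
have rho_gt0 : (0 < rho setT)%E.
  rewrite lt0e measure_ge0 andbT; apply/eqP => rhoT.
  move/null_content_dominatesP : pi_rho => /(_ setT measurableT rhoT) piT.
  by have /eqP := etrans (esym (probability_setT pi)) piT; rewrite onee_eq0.
have [s s_max] := dual_value_max a b e int_fst int_snd rho_gt0.
have [rho1 rho1E] := marginal_measure measurable_fst rho.
have [rho2 rho2E] := marginal_measure measurable_snd rho.
have rho1_pt x : rho1 [set x] = 0%E.
  rewrite rho1E; move/null_content_dominatesP : rho_pi; apply.
    by rewrite -[_ @^-1` _]setTI; apply: measurable_fst => //; exact: measurable_set1.
  by apply: (etrans (pi1 _ (measurable_set1 x))); exact: atomless_point.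
have rho2_pt x : rho2 [set x] = 0%E.
  rewrite rho2E; move/null_content_dominatesP : rho_pi; apply.
    by rewrite -[_ @^-1` _]setTI; apply: measurable_snd => //; exact: measurable_set1.
  by apply: (etrans (pi2 _ (measurable_set1 x))); exact: atomless_point.
have balance := dual_balance int_fst int_snd (fun A _ => rho1E A) (fun A _ => rho2E A)
  s_max inj_a inj_b rho1_pt rho2_pt.
have mfst i : measurable (cell_fst s i : set (line R)) by exact: cell_measurable.
have msnd i : measurable (cell_snd s i : set (line R)) by exact: cell_measurable.
have mUfst : measurable (~` \bigcup_i cell_fst s i : set (line R)).
  by apply/measurableC/fin_bigcup_measurable.
have mUsnd : measurable (~` \bigcup_i cell_snd s i : set (line R)).
  by apply/measurableC/fin_bigcup_measurable.
have [beta [beta1 beta2 beta0]] := block_coupling mfst msnd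
  (@cell_trivIset _ _ _ _) (@cell_trivIset _ _ _ _) balance
  ((negligibleP _ mUfst).1 (ties_negligible _ inj_a rho1_pt))
  ((negligibleP _ mUsnd).1 (ties_negligible _ inj_b rho2_pt)).
have mblocks : measurable (\bigcup_i (cell_fst s i `*` cell_snd s i)
    : set (line R * line R)%type).
  by apply: fin_bigcup_measurable => // i _; exact: measurableX.
pose W (z : R * R) := potential_fst a s z.1 + potential_snd b e s z.2.
have rho1' A : measurable A -> rho (fst @^-1` A) = beta (fst @^-1` A).
  by move=> mA; rewrite beta1// rho1E.
have rho2' A : measurable A -> rho (snd @^-1` A) = beta (snd @^-1` A).
  by move=> mA; rewrite beta2// rho2E.
have mEf : measurable_fun setT (EFin \o potential_fst a s : line R -> \bar R).
  by apply/measurable_EFinP; exact: measurable_envelope.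
have mEs : measurable_fun setT (EFin \o potential_snd b e s : line R -> \bar R).
  by apply/measurable_EFinP; exact: measurable_envelope.
have [bint1 bE1] := integral_marginal measurable_fst rho1' mEf
  (integrable_potential_fst a int_fst s).
have [bint2 bE2] := integral_marginal measurable_snd rho2' mEs
  (integrable_potential_snd b e int_snd s).
have rhoW := integrable_potentials a b e int_fst int_snd s.
have betaW : beta.-integrable setT (EFin \o W).
  exact: (integrableD measurableT bint1 bint2).
(* [W] is a sum of functions of one coordinate, and [beta] and [rho] share their marginals. *)
have intW : (\int[beta]_z (W z)%:E = \int[rho]_z (W z)%:E)%E.
  rewrite /W; under eq_integral do rewrite EFinD.
  under [RHS]eq_integral do rewrite EFinD.
  rewrite integralD// integralD//; last 2 first.
  - exact: integrable_potential_fst.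
  - exact: integrable_potential_snd.
  by congr (_ + _)%E.
have betaN : beta.-negligible [set z | min_cost l z <> W z].
  have off : beta.-negligible (~` \bigcup_i (cell_fst s i `*` cell_snd s i)).
    by apply/negligibleP => //; exact: measurableC.
  apply: negligibleS off => -[x y] /= + [i _ [xi yi]]; apply.
  by rewrite (min_cost_block xi yi) /W (potentials_block xi yi).
have := optimal_potential_ae sol piE (fun A mA => esym (rho1' A mA))
  (fun A mA => esym (rho2' A mA)) (potentials_le_cost s) rhoW betaW intW betaN.
move=> rhoN; exists s.
have piN : pi.-negligible [set z | min_cost l z <> W z].
  have [N [mN N0 sN]] := rhoN; exists N; split=> //.
  by move/null_content_dominatesP : pi_rho; apply.
have pi1N : pi.-negligible (fst @^-1` (~` \bigcup_i cell_fst s i)).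
  have [N [mN N0 sN]] := ties_negligible (fun j => - s j) inj_a
    (fun x => atomless_point x muA).
  exists (fst @^-1` N); split; last by move=> z /sN.
    by rewrite -[_ @^-1` _]setTI; exact: measurable_fst.
  by rewrite pi1.
have pi2N : pi.-negligible (snd @^-1` (~` \bigcup_i cell_snd s i)).
  have [N [mN N0 sN]] := ties_negligible (fun j => e j + s j) inj_b
    (fun x => atomless_point x nuA).
  exists (snd @^-1` N); split; last by move=> z /sN.
    by rewrite -[_ @^-1` _]setTI; exact: measurable_snd.
  by rewrite pi2.
apply: negligibleS (negligibleU piN (negligibleU pi1N pi2N)) => z zN.
have [|tight] := pselect (min_cost l z <> W z); first by left.
right; have [|h1] := pselect ((~` \bigcup_i cell_fst s i) z.1); first by left.
right=> h2; apply: zN; apply: tight_block => //; exact: contrapT.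
Qed.

End BlockStructure.

(** * From blocks to a partition *)

(** If [a1 = a2], the equation [l1 = l2] does not involve [x], so its solution set is invariant
    under horizontal translations; likewise for [b1 = b2] and vertical ones. *)
Lemma assumption_A_slopes (R : realType) (l1 l2 : R * R -> R) (a1 b1 e1 a2 b2 e2 : R) :
  (forall x y, l1 (x, y) = a1 * x + b1 * y + e1) ->
  (forall x y, l2 (x, y) = a2 * x + b2 * y + e2) ->
  assumption_A l1 l2 -> a1 <> a2 /\ b1 <> b2.
Proof.
move=> l1E l2E [_ _ nh nv]; split=> e; [apply: nh|apply: nv];
  by move=> [x y] /= + t; rewrite !l1E !l2E /= e => ?; lra.
Qed.

(** Listing [P] first and its complement afterwards yields the renumbering of the functions. *)
Lemma perm_of_enum (n : nat) (P : {set 'I_n}) : exists sigma : {perm 'I_n},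
  forall (k_le_n : (#|P| <= n)%N) (i : 'I_#|P|),
    sigma (widen_ord k_le_n i) = enum_val i.
Proof.
pose s := enum P ++ enum (~: P).
have size_s : size s = n by rewrite size_cat -!cardE cardsC card_ord.
have uniq_s : uniq s.
  rewrite cat_uniq !enum_uniq andbT/=; apply/hasPn => x.
  by rewrite !mem_enum inE.
(* The index serves as its own default, since ['I_n] may be empty; it stays below the size of
   [s]. *)
have inj_s : injective (fun i : 'I_n => nth i s i).
  move=> i j; rewrite (set_nth_default i) ?size_s// => /eqP.
  by rewrite nth_uniq ?size_s// => /eqP/val_inj.
exists (perm inj_s) => k_le_n i.
by rewrite permE nth_cat /= -cardE ltn_ord -enum_val_nth.
Qed.

(** * Discarding the massless cells *)

Section PositiveCells.
Variables (R : realType) (n : nat) (p q : 'I_n.+1 -> R) (P : {set 'I_n.+1}).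
Variable r : probability (line R) R.
Hypothesis inj_p : injective p.
Hypothesis r_points : forall x : line R, r [set x] = 0%E.
Hypothesis rP : forall i, i \notin P -> r (cell p q i) = 0%E.

(** What remains consists of ties and of finitely many massless cells. *)
Lemma outside_cells_negligible : r.-negligible (~` \bigcup_(i in [set` P]) cell p q i).
Proof.
have mC i : measurable (cell p q i : set (line R)) by exact: cell_measurable.
have null : r.-negligible (\bigcup_(i in [set` ~: P]) cell p q i).
  apply/negligibleP; first exact: fin_bigcup_measurable.
  rewrite bigcup_pred measure_bigsetU_ord//; last exact: cell_trivIset.
  by rewrite big1// => i; rewrite inE => /rP.
apply: negligibleS (negligibleU (ties_negligible q inj_p r_points) null) => x xP.
have [[i _ xi]|] := pselect ((\bigcup_i cell p q i) x); last by left.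
right; exists i => //=; rewrite inE; apply: contra_notN xP => iP.
by exists i.
Qed.

Variable A : 'I_n.+1 -> set R.
Hypothesis cellA : forall i, cell p q i `<=` A i.
Hypothesis trivA : trivIset [set` P] A.

(** The extended sets are disjoint over [P], so what is added to one cell lies outside all the cells
    of [P]. *)
Lemma extension_negligible i : i \in P -> r.-negligible (A i `\` cell p q i).
Proof.
move=> iP; apply: negligibleS outside_cells_negligible => x [xA xi] [j jP xj].
have ij : i = j by apply: trivA => //; exists x; split=> //; exact: cellA.
by apply: xi; rewrite ij.
Qed.

Lemma measure_extension_cell i : i \in P -> measurable (A i : set (line R)) ->
  r (A i) = r (cell p q i).
Proof.
move=> iP mA; have mC : measurable (cell p q i : set (line R)) by exact: cell_measurable.
rewrite -(setDUK (@cellA i)) measureU0//; first exact: measurableD.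
by apply/negligibleP; [exact: measurableD|exact: extension_negligible].
Qed.

End PositiveCells.

Theorem theorem2p7 (R : realType) (mu nu : probability (line R) R)
    (n : nat) (l : 'I_n.+1 -> R * R -> R) :
  atomless mu -> atomless nu ->
  (forall i, affine_function (l i)) ->
  (forall i j, i != j -> assumption_A (l i) (l j)) ->
  (forall i, interior [set p : R * R | min_cost l p = l i p] !=set0) ->
  forall pi : probability (line R * line R)%type R,
    MK_solution mu nu (min_cost l) pi ->
    exists (k : nat) (k_le_n : (k <= n.+1)%N) (I J : 'I_k -> set R)
        (sigma : {perm 'I_n.+1}),
      [/\ munu_partition mu nu I J,
          concentrated_on pi (\bigcup_i (I i `*` J i))
        & forall i : 'I_k,
            pi (I i `*` J i) = 0%E \/
            equal_on_block mu nu (min_cost l) (l (sigma (widen_ord k_le_n i)))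
              (I i) (J i)].
Proof.
move=> muA nuA affl A_l _ pi sol.
have /choice[abe lE] : forall i, exists t : R * R * R,
    forall x y, l i (x, y) = t.1.1 * x + t.1.2 * y + t.2.
  by move=> i; have [a [b [e abe]]] := affl i; exists (a, b, e).
pose a i := (abe i).1.1; pose b i := (abe i).1.2; pose e i := (abe i).2.
have {}lE i x y : l i (x, y) = a i * x + b i * y + e i by exact: lE.
have inj_a : injective a.
  move=> i j aij; apply/eqP/negP => /negP /A_l.
  by case/(assumption_A_slopes (lE i) (lE j)).
have inj_b : injective b.
  move=> i j bij; apply/eqP/negP => /negP /A_l.
  by case/(assumption_A_slopes (lE i) (lE j)).
have [s off] := solution_blocks lE inj_a inj_b muA nuA sol.
have [[pi1 pi2] _ _] := sol.
pose A := cell_fst a s; pose B := cell_snd b e s.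
have mA i : measurable (A i : set (line R)) by exact: cell_measurable.
have mB i : measurable (B i : set (line R)) by exact: cell_measurable.
have mu_pt x : mu [set x] = 0%E by exact: atomless_point.
have nu_pt x : nu [set x] = 0%E by exact: atomless_point.
have tA : trivIset setT A by exact: cell_trivIset.
have tB : trivIset setT B by exact: cell_trivIset.
have mfst (C : set (line R)) : measurable C ->
    measurable (fst @^-1` C : set (line R * line R)%type).
  by move=> mC; rewrite -[_ @^-1` _]setTI; exact: measurable_fst.
have msnd (C : set (line R)) : measurable C ->
    measurable (snd @^-1` C : set (line R * line R)%type).
  by move=> mC; rewrite -[_ @^-1` _]setTI; exact: measurable_snd.
(* As [pi] lives on the blocks, a set that meets their union exactly in one block has the mass of
   that block. *)
have block_mass i (C : set (line R * line R)%type) : measurable C ->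
    A i `*` B i `<=` C ->
    C `&` \bigcup_j (A j `*` B j) `<=` A i `*` B i -> pi C = pi (A i `*` B i).
  move=> mC sub sup.
  have mAB : measurable (A i `*` B i : set (line R * line R)%type).
    exact: measurableX.
  rewrite -(setDUK sub) measureU0//; first exact: measurableD.
  apply/negligibleP; first exact: measurableD.
  by apply: negligibleS off => z [Cz zAB] zU; apply: zAB; exact: sup.
(* The vertical strip over [A i] and the horizontal strip over [B i] both have the [pi]-mass of the
   block. *)
have mu_nu i : mu (A i) = nu (B i).
  rewrite -pi1// -pi2// [LHS](block_mass i)//; last 3 first.
  - exact: mfst.
  - by move=> z [].
  - move=> [x y] /= [xi [j _ [xj yj]]].
    by have -> : i = j by apply: tA => //; exists x.
  apply/esym/block_mass => //; [exact: msnd|by move=> z []|].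
  move=> [x y] /= [yi [j _ [xj yj]]].
  by have -> : i = j by apply: tB => //; exists y.
(* A partition requires positive masses, so only these cells are kept and extended to cover the
   line; their number is the order [k]. *)
pose P := [set i | mu (A i) != 0%E]%SET.
have muP i : i \notin P -> mu (A i) = 0%E by rewrite inE negbK => /eqP.
have nuP i : i \notin P -> nu (B i) = 0%E by rewrite -mu_nu; exact: muP.
have mu_off := outside_cells_negligible inj_a mu_pt muP.
have P0 : P != finset.set0.
  apply: contraPneq mu_off => P0; rewrite P0.
  rewrite (_ : [set` finset.set0] = set0); last first.
    by apply/seteqP; split=> // i; rewrite /= inE.
  rewrite bigcup_set0 setC0 => /(negligibleP _ measurableT) muT.
  by have /eqP := etrans (esym (probability_setT mu)) muT; rewrite onee_eq0.
have A_nonempty i : i \in P -> A i !=set0.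
  by rewrite inE; apply: contra_neqP => /set0P/negP/negPn/eqP ->; rewrite measure0.
have B_nonempty i : i \in P -> B i !=set0.
  by rewrite inE mu_nu; apply: contra_neqP => /set0P/negP/negPn/eqP ->; rewrite measure0.
have [I0 [AI I_itv tI coverI]] := cell_extension (fun j => - s j) inj_a P0.
have [J0 [BJ J_itv tJ coverJ]] := cell_extension (fun j => e j + s j) inj_b P0.
have mI i : measurable (I0 i : set (line R)) by exact: is_interval_measurable.
have mJ i : measurable (J0 i : set (line R)) by exact: is_interval_measurable.
have [sigma sigmaE] := perm_of_enum P.
have k_le_n : (#|P| <= n.+1)%N by rewrite -[X in (_ <= X)%N]card_ord max_card.
exists #|P|, k_le_n, (I0 \o enum_val), (J0 \o enum_val), sigma.
have connected_blocks (C C0 : 'I_n.+1 -> set R) : (forall i, C0 i `<=` C i) ->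
    (forall i, i \in P -> C0 i !=set0) -> (forall i, is_interval (C i)) ->
    trivIset [set` P] C -> \bigcup_(i in [set` P]) C i = setT ->
    connected_partition (C \o enum_val : 'I_#|P| -> set R).
  move=> C0C C0_nonempty C_itv tC coverC; split; first split.
  - apply/seteqP; split=> // x _; have : (\bigcup_(i in [set` P]) C i) x.
      by rewrite coverC.
    move=> [i iP xi]; exists (enum_rank_in iP i) => //=.
    by rewrite enum_rankK_in.
  - move=> i j _ _ [x [xi xj]]; apply: enum_val_inj.
    by apply: tC; [exact: enum_valP|exact: enum_valP|exists x].
  - by move=> i _; have [x xi] := C0_nonempty _ (enum_valP i); exists x; exact: C0C.
  - by move=> i; apply/connected_intervalP; exact: C_itv.
split.
- split.
  + exact: connected_blocks AI A_nonempty I_itv tI coverI.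
  + exact: connected_blocks BJ B_nonempty J_itv tJ coverJ.
  move=> i /=.
  rewrite (measure_extension_cell inj_a mu_pt muP AI tI (enum_valP i))//.
  rewrite (measure_extension_cell inj_b nu_pt nuP BJ tJ (enum_valP i))//.
  split; first exact: mu_nu.
  by rewrite lt0e measure_ge0 andbT; have := enum_valP i; rewrite inE.
- have mblocks : measurable (\bigcup_(i in [set: 'I_#|P|])
      (I0 (enum_val i) `*` J0 (enum_val i)) : set (line R * line R)%type).
    by apply: fin_bigcup_measurable => // i _; exact: measurableX.
  apply/negligibleP; first exact: measurableC.
  (* Almost surely the point lies in a block and its first coordinate in a cell of [P]; disjointness
     of the cells makes the two indices agree. *)
  have null : pi.-negligible (fst @^-1` (~` \bigcup_(i in [set` P]) A i)).
    have [N [mN N0 sN]] := mu_off.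
    by exists (fst @^-1` N); split; [exact: mfst|rewrite pi1|move=> z /sN].
  apply: negligibleS (negligibleU off null) => -[x y] xy.
  have [[i _ [xi yi]]|] := pselect ((\bigcup_i (A i `*` B i)) (x, y)); last by left.
  right=> -[j jP xj]; apply: xy.
  have ij : i = j by apply: tA => //; exists x.
  exists (enum_rank_in jP j) => //=; rewrite enum_rankK_in// -ij.
  by split; [exact: AI|exact: BJ].
- move=> i; right; rewrite sigmaE.
  (* The exceptional null sets are what the extension added to the cells; off them the point lies in
     the original block, where the cost is [l i]. *)
  exists (I0 (enum_val i) `\` A (enum_val i)), (J0 (enum_val i) `\` B (enum_val i)).
  split.
  + exact: (extension_negligible inj_a mu_pt muP AI tI (enum_valP i)).
  + exact: (extension_negligible inj_b nu_pt nuP BJ tJ (enum_valP i)).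
  + move=> x y [xI xA] [yJ yB]; apply: (min_cost_block lE (s := s)).
    * by apply: contrapT => xiA; apply: xA.
    * by apply: contrapT => yiB; apply: yB.
Qed.
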